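(* Let $\mathcal{H}$ be a complex Hilbert space and let $A,D\in\mathcal{B}(\mathcal{H})$. Then $$\|AD^*\|\le\left\|\int_0^1\left((1-t)\left(\frac{|A|^2+|D|^2}{2}\right)+t\|AD^*\|I\right)^2dt\right\|^{1/2}\le\frac12\left\||A|^2+|D|^2\right\|.$$
   Context: $\mathcal{B}(\mathcal{H})$ is the set of bounded linear operators on $\mathcal{H}$, $A^*$ is the adjoint of $A$, $|A|=(A^*A)^{1/2}$, $I$ is the identity operator, and $\|\cdot\|$ is the operator norm. The integral is the integral over $[0,1]$ of a norm-continuous operator-valued function. *)

(* Defs.v *)
From Stdlib Require Export Reals.
From Stdlib Require Import Lra ClassicalEpsilon FunctionalExtensionality
  PropExtensionality ProofIrrelevance.
From Coquelicot Require Export Coquelicot.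
Open Scope R_scope.

(* The inner product is linear in its first argument; positive definiteness
   follows from inner_norm and the norm axioms. *)
Record HilbertSpace := {
  Hilbert_carrier :> CompleteNormedModule C_AbsRing;
  inner : Hilbert_carrier -> Hilbert_carrier -> C;
  inner_plus_l : forall x y z,
    inner (plus x y) z = Cplus (inner x z) (inner y z);
  inner_scal_l : forall (k : C) x y,
    inner (scal k x) y = Cmult k (inner x y);
  inner_conj : forall x y, inner y x = Cconj (inner x y);
  inner_norm : forall x, inner x x = RtoC (norm x ^ 2)
}.
Arguments inner {h}.

Section BoundedOperators.

Context {H : CompleteNormedModule C_AbsRing}.

(* Coquelicot's is_linear includes boundedness. *)
Record bop := Bop {
  bop_fun :> H -> H;
  bop_linear : is_linear bop_fun
}.

Lemma bop_ext (A B : bop) : (forall x, A x = B x) -> A = B.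
Proof.
destruct A as [a la], B as [b lb]; simpl; intros E.
assert (a = b) by (apply functional_extensionality; exact E).
subst b; f_equal; apply proof_irrelevance.
Qed.

Lemma bop_plus_linear (A B : bop) : is_linear (fun x => plus (A x) (B x)).
Proof.
exact (is_linear_comp (fun x => (A x, B x)) (fun t => plus (fst t) (snd t))
  (is_linear_prod _ _ (bop_linear A) (bop_linear B)) is_linear_plus).
Qed.

Lemma bop_opp_linear (A : bop) : is_linear (fun x => opp (A x)).
Proof. exact (is_linear_comp _ _ (bop_linear A) is_linear_opp). Qed.

Lemma bop_scal_linear (r : R) (A : bop) :
  is_linear (fun x => scal (RtoC r : C_AbsRing) (A x)).
Proof.
refine (is_linear_comp _ _ (bop_linear A) (is_linear_scal_r _ _)).
exact Cmult_comm.
Qed.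

Lemma bop_at_zero (A : bop) : A (zero : H) = (zero : H).
Proof. exact (linear_zero A (bop_linear A)). Qed.

Lemma norm_zero_H : norm (zero : H) = 0.
Proof. exact (@norm_zero C_AbsRing H). Qed.

Lemma norm_scal_H (k : C_AbsRing) (x : H) : norm (scal k x) <= abs k * norm x.
Proof. exact (@norm_scal C_AbsRing H k x). Qed.

Lemma norm_scal_R_H (r : R) (x : H) :
  norm (scal (RtoC r : C_AbsRing) x) <= Rabs r * norm x.
Proof. rewrite <- Cmod_R; exact (norm_scal_H (RtoC r) x). Qed.

Lemma norm_triangle_H (x y : H) : norm (plus x y) <= norm x + norm y.
Proof. exact (@norm_triangle C_AbsRing H x y). Qed.

Lemma norm_opp_H (x : H) : norm (opp x) = norm x.
Proof. exact (@norm_opp C_AbsRing H x). Qed.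

Lemma norm_ge_0_H (x : H) : 0 <= norm x.
Proof. exact (@norm_ge_0 C_AbsRing H x). Qed.

Lemma norm_eq_zero_H (x : H) : norm x = 0 -> x = zero.
Proof. exact (@norm_eq_zero C_AbsRing H x). Qed.

Lemma bop_at_plus (A : bop) (x y : H) : A (plus x y) = plus (A x) (A y).
Proof. exact (linear_plus A (bop_linear A) x y). Qed.

Lemma bop_at_scal (A : bop) (k : C_AbsRing) (x : H) :
  A (scal k x) = scal k (A x).
Proof. exact (linear_scal A (bop_linear A) k x). Qed.

Definition bop_plus (A B : bop) := Bop _ (bop_plus_linear A B).
Definition bop_opp (A : bop) := Bop _ (bop_opp_linear A).
Definition bop_zero := Bop _ (@is_linear_zero C_AbsRing H H).
Definition bop_scal (r : R) (A : bop) := Bop _ (bop_scal_linear r A).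
Definition bop_id := Bop _ (@is_linear_id C_AbsRing H).
Definition bop_comp (A B : bop) :=
  Bop (fun x => A (B x)) (is_linear_comp B A (bop_linear B) (bop_linear A)).

Definition bop_AbelianMonoid_mixin : AbelianMonoid.mixin_of bop.
Proof.
apply (AbelianMonoid.Mixin bop bop_plus bop_zero).
- intros; apply bop_ext; intro; apply plus_comm.
- intros; apply bop_ext; intro; apply plus_assoc.
- intros; apply bop_ext; intro; apply plus_zero_r.
Defined.

Canonical bop_AbelianMonoid := AbelianMonoid.Pack bop bop_AbelianMonoid_mixin bop.

Definition bop_AbelianGroup_mixin : AbelianGroup.mixin_of bop_AbelianMonoid.
Proof.
apply (AbelianGroup.Mixin bop_AbelianMonoid bop_opp).
intros; apply bop_ext; intro; apply (plus_opp_r (G := H)).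
Defined.

Canonical bop_AbelianGroup :=
  AbelianGroup.Pack bop (AbelianGroup.Class _ _ bop_AbelianGroup_mixin) bop.

(* The scalars are restricted to R because RInt takes values in a
   CompleteNormedModule over R. *)
Definition bop_ModuleSpace_mixin :
  ModuleSpace.mixin_of R_AbsRing bop_AbelianGroup.
Proof.
apply (ModuleSpace.Mixin R_AbsRing bop_AbelianGroup bop_scal).
- intros x y u; apply bop_ext; intro h; simpl.
  rewrite scal_assoc; f_equal; symmetry; apply RtoC_mult.
- intros u; apply bop_ext; intro h; simpl.
  exact (@scal_one C_AbsRing H _).
- intros x u v; apply bop_ext; intro h; simpl.
  exact (@scal_distr_l C_AbsRing H _ _ _).
- intros x y u; apply bop_ext; intro h; simpl.
  change (RtoC (plus x y)) with (RtoC (x + y)); rewrite RtoC_plus.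
  exact (@scal_distr_r C_AbsRing H _ _ _).
Defined.

Canonical bop_ModuleSpace :=
  ModuleSpace.Pack R_AbsRing bop
    (ModuleSpace.Class _ _ _ bop_ModuleSpace_mixin) bop.

(* The supremum is finite: see opnorm_lub. *)
Definition opnorm (A : bop) : R :=
  real (Lub_Rbar (fun r => exists x : H, norm x <= 1 /\ r = norm (A x))).

Lemma opnorm_lub (A : bop) :
  is_lub_Rbar (fun r => exists x : H, norm x <= 1 /\ r = norm (A x)) (opnorm A).
Proof.
unfold opnorm.
set (E := fun r => exists x : H, norm x <= 1 /\ r = norm (A x)).
assert (L := Lub_Rbar_correct E).
destruct (linear_norm _ (bop_linear A)) as [M [HM HA]].
assert (E0 : E 0).
{ exists (zero : H); rewrite bop_at_zero, !norm_zero_H; lra. }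
assert (U : Rbar_le (Lub_Rbar E) M).
{ apply L; intros r [x [Hx ->]]; simpl.
  apply Rle_trans with (1 := HA x).
  apply Rle_trans with (M * 1); [apply Rmult_le_compat_l|]; lra. }
assert (B : Rbar_le 0 (Lub_Rbar E)) by (apply L; exact E0).
destruct (Lub_Rbar E); simpl in *; easy.
Qed.

Lemma opnorm_ge0 (A : bop) : 0 <= opnorm A.
Proof.
apply (proj1 (opnorm_lub A) 0); exists (zero : H).
rewrite bop_at_zero, !norm_zero_H; lra.
Qed.

Lemma norm_bop_le (A : bop) (x : H) : norm (A x) <= opnorm A * norm x.
Proof.
destruct (Req_dec (norm x) 0) as [E|E].
{ replace x with (zero : H) by (symmetry; exact (norm_eq_zero_H x E)).
  rewrite bop_at_zero, !norm_zero_H; lra. }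
assert (P : 0 < norm x) by (generalize (norm_ge_0_H x); lra).
set (y := scal (RtoC (/ norm x) : C_AbsRing) x).
assert (Hy : norm (A y) <= opnorm A).
{ apply (proj1 (opnorm_lub A) (norm (A y))); exists y; split; auto.
  unfold y; apply Rle_trans with (1 := norm_scal_R_H _ _).
    rewrite Rabs_pos_eq; [right; field; lra|].
  left; now apply Rinv_0_lt_compat. }
assert (Hx : x = scal (RtoC (norm x) : C_AbsRing) y).
{ unfold y; rewrite scal_assoc.
  change (mult (RtoC (norm x) : C_AbsRing) (RtoC (/ norm x) : C_AbsRing))
    with (Cmult (RtoC (norm x)) (RtoC (/ norm x))).
  rewrite <- RtoC_mult, Rinv_r by lra.
  symmetry; exact (@scal_one C_AbsRing H _). }
rewrite Hx at 1; rewrite bop_at_scal.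
apply Rle_trans with (1 := norm_scal_R_H _ _).
rewrite Rabs_pos_eq by lra; rewrite Rmult_comm.
apply Rmult_le_compat_r; lra.
Qed.

Lemma opnorm_le (A : bop) (M : R) :
  0 <= M -> (forall x, norm (A x) <= M * norm x) -> opnorm A <= M.
Proof.
intros HM HA; apply (proj2 (opnorm_lub A) M); intros r [x [Hx ->]]; simpl.
apply Rle_trans with (1 := HA x).
apply Rle_trans with (M * 1); [apply Rmult_le_compat_l|]; lra.
Qed.

Lemma opnorm_triangle (A B : bop) :
  opnorm (bop_plus A B) <= opnorm A + opnorm B.
Proof.
generalize (opnorm_ge0 A) (opnorm_ge0 B); intros.
apply opnorm_le; [lra|]; intros x; simpl.
apply Rle_trans with (1 := norm_triangle_H _ _).
rewrite Rmult_plus_distr_r; apply Rplus_le_compat; apply norm_bop_le.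
Qed.

Lemma opnorm_opp (A : bop) : opnorm (bop_opp A) = opnorm A.
Proof.
unfold opnorm; f_equal; apply Lub_Rbar_eqset; intro r; split;
  intros [x [Hx ->]]; exists x; split; auto; simpl;
  now rewrite norm_opp_H.
Qed.

Lemma opnorm_scal (r : R) (A : bop) :
  opnorm (bop_scal r A) <= Rabs r * opnorm A.
Proof.
apply opnorm_le.
{ apply Rmult_le_pos; [apply Rabs_pos | apply opnorm_ge0]. }
intros x; simpl; apply Rle_trans with (1 := norm_scal_R_H _ _).
rewrite Rmult_assoc; apply Rmult_le_compat_l;
  [apply Rabs_pos | apply norm_bop_le].
Qed.

Lemma opnorm_zero : opnorm bop_zero = 0.
Proof.
apply Rle_antisym; [|apply opnorm_ge0].
apply opnorm_le; [lra|]; intros x; change (norm (zero : H) <= 0 * norm x).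
rewrite norm_zero_H; lra.
Qed.

Lemma opnorm_eq0 (A : bop) : opnorm A = 0 -> A = bop_zero.
Proof.
intros E; apply bop_ext; intros x; simpl; apply norm_eq_zero_H.
apply Rle_antisym; [|apply norm_ge_0_H].
generalize (norm_bop_le A x); rewrite E; lra.
Qed.

Definition bop_ball (A : bop) (eps : R) (B : bop) : Prop :=
  opnorm (minus B A) < eps.

Definition bop_UniformSpace_mixin : UniformSpace.mixin_of bop.
Proof.
apply (UniformSpace.Mixin bop bop_zero bop_ball); unfold bop_ball.
- intros A e; rewrite minus_eq_zero; change (opnorm bop_zero < e).
  rewrite opnorm_zero; apply cond_pos.
- intros A B e L; rewrite <- opp_minus.
  change (opnorm (bop_opp (minus B A)) < e); now rewrite opnorm_opp.
- intros A B C e1 e2 L1 L2; rewrite (minus_trans B C A).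
  apply Rle_lt_trans with (1 := opnorm_triangle _ _); lra.
Defined.

Canonical bop_UniformSpace :=
  UniformSpace.Pack bop bop_UniformSpace_mixin bop.

Canonical bop_NormedModuleAux :=
  NormedModuleAux.Pack R_AbsRing bop
    (NormedModuleAux.Class _ _ (ModuleSpace.class _ bop_ModuleSpace)
      bop_UniformSpace_mixin) bop.

Definition bop_NormedModule_mixin :
  NormedModule.mixin_of R_AbsRing bop_NormedModuleAux.
Proof.
apply (NormedModule.Mixin R_AbsRing bop_NormedModuleAux opnorm 1).
- exact opnorm_triangle.
- exact opnorm_scal.
- intros A B eps L; exact L.
- intros A B eps L; rewrite Rmult_1_l; exact L.
- exact opnorm_eq0.
Defined.

Canonical bop_NormedModule :=
  NormedModule.Pack R_AbsRing bop
    (NormedModule.Class _ _ _ bop_NormedModule_mixin) bop.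

Lemma bop_complete (F : (bop -> Prop) -> Prop) :
  ProperFilter F -> cauchy F ->
  exists L : bop, forall eps : posreal, F (ball L eps).
Proof.
intros PF CF.
assert (Clt : forall (A B : bop) e x, ball A e B ->
  norm (minus (B x) (A x)) <= e * norm x).
{ intros A B e x L; apply Rle_trans with (1 := norm_bop_le (minus B A) x).
  apply Rmult_le_compat_r; [apply norm_ge_0_H | apply Rlt_le, L]. }
assert (Pt : forall x : H, exists l : H, forall e : posreal,
  F (fun A => norm (minus (A x) l) < e)).
{ intros x.
  set (G := filtermap (fun A : bop => A x) F).
  assert (PG : ProperFilter G) by (apply filtermap_proper_filter; exact PF).
  assert (CG : cauchy G).
  { intros e; assert (Hx := norm_ge_0_H x).
    assert (Pe : 0 < e / (norm x + 1))
      by (apply Rdiv_lt_0_compat; [apply cond_pos | lra]).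
    destruct (CF (mkposreal _ Pe)) as [A0 HA0].
    exists (A0 x); unfold G, filtermap.
    apply filter_imp with (2 := HA0); intros A L.
    apply (@norm_compat1 C_AbsRing H); apply Rle_lt_trans with (1 := Clt _ _ _ x L); simpl.
    apply Rlt_le_trans with (e / (norm x + 1) * (norm x + 1)).
    - apply Rmult_lt_compat_l; lra.
    - right; field; lra. }
  exists (lim G); intros e.
  assert (Nf := @norm_factor_gt_0 _ H).
  assert (Pe : 0 < e / @norm_factor _ H)
    by (apply Rdiv_lt_0_compat; [apply cond_pos | lra]).
  generalize (complete_cauchy G PG CG (mkposreal _ Pe)).
  unfold G at 1, filtermap; apply filter_imp; intros A L.
  apply Rlt_le_trans with (1 := @norm_compat2 C_AbsRing H _ _ _ L); simpl.
  right; field; lra. }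
destruct (choice _ Pt) as [l Hl].
assert (Eq0 : forall (v : H) K,
  (forall e, 0 < e -> norm v <= K * e) -> v = zero).
{ intros v K Hv; apply norm_eq_zero_H; apply Rle_antisym; [|apply norm_ge_0_H].
  apply Rnot_lt_le; intros Hp.
  assert (HK := Rle_abs K); assert (HK0 := Rabs_pos K).
  assert (Pe : 0 < norm v / (2 * (Rabs K + 1)))
    by (apply Rdiv_lt_0_compat; lra).
  specialize (Hv _ Pe).
  assert (K * (norm v / (2 * (Rabs K + 1))) <=
    (Rabs K + 1) * (norm v / (2 * (Rabs K + 1))))
    by (apply Rmult_le_compat_r; lra).
  replace ((Rabs K + 1) * (norm v / (2 * (Rabs K + 1)))) with (norm v / 2)
    in * by (field; lra).
  lra. }
assert (Le : forall a b : R, (forall e, 0 < e -> a <= b + e) -> a <= b)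
  by (exact le_epsilon).
assert (Sym : forall u v : H, norm (minus u v) = norm (minus v u))
  by (intros u v; rewrite <- (@opp_minus H v u); apply norm_opp_H).
assert (Tri : forall u v w : H,
  norm (minus u w) <= norm (minus u v) + norm (minus v w))
  by (intros u v w; rewrite (@minus_trans H v u w); apply norm_triangle_H).
assert (Mz : forall u : H, norm (minus u zero) = norm u)
  by (intros u; exact (f_equal norm (@minus_zero_r H u))).
assert (Ll : is_linear l).
{ split.
  - intros x y; apply (@plus_reg_r H) with (opp (plus (l x) (l y))).
    rewrite (@plus_opp_r H); change (minus (l (plus x y)) (plus (l x) (l y)) = zero).
    apply Eq0 with 3; intros e He.
    destruct (filter_ex _ (filter_and _ _ (Hl (plus x y) (mkposreal e He))
      (filter_and _ _ (Hl x (mkposreal e He)) (Hl y (mkposreal e He)))))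
      as [A [H1 [H2 H3]]]; simpl in H1, H2, H3.
    apply Rle_trans with (1 := Tri _ (A (plus x y)) _).
    rewrite Sym, bop_at_plus.
    rewrite bop_at_plus in H1.
    assert (E : minus (plus (A x) (A y)) (plus (l x) (l y)) =
      plus (minus (A x) (l x)) (minus (A y) (l y))).
    { unfold minus; rewrite (@opp_plus H), <- !plus_assoc; f_equal.
      rewrite !plus_assoc; f_equal; apply plus_comm. }
    assert (N : norm (minus (plus (A x) (A y)) (plus (l x) (l y))) <=
      norm (minus (A x) (l x)) + norm (minus (A y) (l y)))
      by (rewrite E; apply norm_triangle_H).
    lra.
  - intros k x; apply (@plus_reg_r H) with (opp (scal k (l x))).
    rewrite (@plus_opp_r H); change (minus (l (scal k x)) (scal k (l x)) = zero).
    apply Eq0 with (1 + abs k); intros e He.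
    destruct (filter_ex _ (filter_and _ _ (Hl (scal k x) (mkposreal e He))
      (Hl x (mkposreal e He)))) as [A [H1 H2]]; simpl in H1, H2.
    apply Rle_trans with (1 := Tri _ (A (scal k x)) _).
    rewrite Sym, bop_at_scal.
    rewrite bop_at_scal in H1.
    assert (E : minus (scal k (A x)) (scal k (l x)) = scal k (minus (A x) (l x)))
      by (unfold minus; rewrite (@scal_distr_l C_AbsRing H), (@scal_opp_r C_AbsRing H); reflexivity).
    assert (N : norm (minus (scal k (A x)) (scal k (l x))) <=
      abs k * norm (minus (A x) (l x)))
      by (rewrite E; apply norm_scal_H).
    assert (abs k * norm (minus (A x) (l x)) <= abs k * e)
      by (apply Rmult_le_compat_l; [apply abs_ge_0 | lra]).
    rewrite Rmult_plus_distr_r, Rmult_1_l.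
    apply Rplus_le_compat; [now left | now apply Rle_trans with (1 := N)].
  - destruct (CF (mkposreal 1 Rlt_0_1)) as [A0 HA0].
    exists (1 + opnorm A0); split; [generalize (opnorm_ge0 A0); lra|].
    intros x; apply Le; intros e He.
    destruct (filter_ex _ (filter_and _ _ HA0 (Hl x (mkposreal e He))))
      as [A [H1 H2]]; simpl in H2.
    apply Clt with (x := x) in H1; simpl in H1.
    assert (N := norm_bop_le A0 x).
    assert (T0 : norm (l x) <= norm (minus (A x) (l x)) + norm (A x))
      by (rewrite <- (Mz (l x)), <- (Mz (A x)), (Sym (A x) (l x)); apply Tri).
    assert (T1 : norm (A x) <= norm (minus (A x) (A0 x)) + norm (A0 x))
      by (rewrite <- (Mz (A x)), <- (Mz (A0 x)); apply Tri).
    lra. }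
exists (Bop l Ll); intros eps.
assert (P4 : 0 < eps / 4) by (generalize (cond_pos eps); lra).
destruct (CF (mkposreal _ P4)) as [A0 HA0].
apply filter_imp with (2 := HA0); intros A HA.
apply Rle_lt_trans with (eps / 2); [|generalize (cond_pos eps); lra].
apply opnorm_le; [generalize (cond_pos eps); lra|].
intros x; change (norm (minus (A x) (l x)) <= eps / 2 * norm x).
apply Le; intros e He.
destruct (filter_ex _ (filter_and _ _ HA0 (Hl x (mkposreal e He))))
  as [B [H1 H2]]; simpl in H2.
apply Clt with (x := x) in H1; apply Clt with (x := x) in HA; simpl in H1, HA.
assert (T0 := Tri (A x) (A0 x) (l x)); assert (T1 := Tri (A0 x) (B x) (l x)).
rewrite (Sym (A0 x) (B x)) in T1; lra.
Qed.

Definition bop_lim (F : (bop -> Prop) -> Prop) : bop :=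
  epsilon (inhabits bop_zero) (fun L => forall eps : posreal, F (ball L eps)).

Definition bop_CompleteSpace_mixin : CompleteSpace.mixin_of bop_UniformSpace.
Proof.
apply (CompleteSpace.Mixin bop_UniformSpace bop_lim).
- intros F PF CF.
  exact (epsilon_spec (inhabits bop_zero) _ (bop_complete F PF CF)).
- intros F G FG GF.
  assert (E : F = G).
  { apply functional_extensionality; intro P.
    apply propositional_extensionality; split; [apply GF | apply FG]. }
  rewrite E; apply close_refl.
Defined.

Canonical bop_CompleteSpace :=
  CompleteSpace.Pack bop
    (CompleteSpace.Class _ bop_UniformSpace_mixin bop_CompleteSpace_mixin) bop.

Canonical bop_CompleteNormedModule :=
  CompleteNormedModule.Pack R_AbsRing bop
    (CompleteNormedModule.Class _ _ (NormedModule.class _ bop_NormedModule)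
      bop_CompleteSpace_mixin) bop.

End BoundedOperators.

Arguments bop H : clear implicits.

Section HilbertOperators.

Context {H : HilbertSpace}.

Definition is_adjoint (A B : bop H) : Prop :=
  forall x y : H, inner (A x) y = inner x (B y).

(* An adjoint exists (Riesz) and is unique, so epsilon selects it. *)
Definition adjoint (A : bop H) : bop H :=
  epsilon (inhabits bop_zero) (is_adjoint A).

Definition bop_positive (A : bop H) : Prop :=
  forall x : H, exists r : R, 0 <= r /\ inner (A x) x = RtoC r.

(* T ^ (1/2) for positive T: the unique positive operator with square T
   (an arbitrary operator if T is not positive). *)
Definition bop_sqrt (T : bop H) : bop H :=
  epsilon (inhabits bop_zero)
    (fun S => bop_positive S /\ bop_comp S S = T).

Definition bop_abs (A : bop H) : bop H := bop_sqrt (bop_comp (adjoint A) A).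

Definition bop_sq (A : bop H) : bop H := bop_comp A A.

End HilbertOperators.

(* Main.v *)
(** Let W = |A|^2 + |D|^2, P = W / 2 and m = ||A D*||. If <W y, y> <= K |y|^2
    for all y, then m <= K / 2: with y = A* u + D* v, polarization gives
    4 Re <A D* v, u> <= |y|^2 and |y|^2 = Re (<A y, u> + <D y, v>) gives
    |y|^2 <= K (|u|^2 + |v|^2). The integral equals Q = (P^2 + m P + m^2 I) / 3.
    As |P y|^2 + m^2 |y|^2 >= 2 m <P y, y>, one has <Q y, y> >= m <P y, y>,
    so K = 2 ||Q|| / m is admissible, whence m^2 <= ||Q||. Conversely
    K = ||W|| is admissible, so m <= ||W|| / 2 and ||Q|| <= ||W||^2 / 4.

    The adjoint exists by the Riesz theorem. A square root of a positive T comes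
    from Y = (R + Y^2) / 2 with R = I - T / k, since then (I - Y)^2 = T / k. *)
Require Import Defs.
From Stdlib Require Import Lra Lia ClassicalEpsilon.

(** * Limits, completeness and integration *)

Lemma le_0_small (a K : R) : (forall s, 0 < s -> a <= K * s) -> a <= 0.
Proof.
intros Ha; apply le_epsilon; intros e He; rewrite Rplus_0_l.
assert (HK := Rabs_pos K); assert (HK' := Rle_abs K).
assert (Hs : 0 < e / (Rabs K + 1)) by (apply Rdiv_lt_0_compat; lra).
apply Rle_trans with (1 := Ha _ Hs).
apply Rle_trans with ((Rabs K + 1) * (e / (Rabs K + 1))).
- apply Rmult_le_compat_r; lra.
- right; field; lra.
Qed.

(** Generic in the scalars because it serves twice: for vectors in the Riesz theorem (over [C]) and
    for operators in the square root iteration (over [R]). *)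
Lemma complete_seq {K : AbsRing} {V : CompleteNormedModule K} (u : nat -> V) :
  (forall eps, 0 < eps -> exists N, forall n m, (N <= n)%nat -> (N <= m)%nat ->
    norm (minus (u m) (u n)) < eps) ->
  exists l, forall eps, 0 < eps -> exists N, forall n, (N <= n)%nat ->
    norm (minus (u n) l) < eps.
Proof.
intros Cu.
destruct (proj1 (@filterlim_locally_cauchy nat V eventually eventually_filter u))
  as [l Hl].
{ intros [e He]; destruct (Cu e He) as [N HN].
  exists (fun n => (N <= n)%nat); split; [exists N; auto|].
  intros n m Hn Hm; apply (norm_compat1 (K := K) (V := V)), HN; assumption. }
exists l; intros e He.
exact (proj1 (filterlim_locally_ball_norm u l) Hl (mkposreal e He)).
Qed.

(** Fundamental theorem of calculus for a scalar function times a fixed vector; it reduces the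
    operator integral to real antiderivatives. *)
Lemma is_RInt_scal_vec {V : CompleteNormedModule R_AbsRing} (G g : R -> R)
  (a b : R) (v : V) :
  (forall x, is_derive G x (g x)) -> (forall x, continuous g x) ->
  is_RInt (fun t => scal (g t) v) a b (scal (G b - G a) v).
Proof.
intros HG Hg.
replace (scal (G b - G a) v) with (minus (scal (G b) v) (scal (G a) v)).
- apply (is_RInt_derive (fun t => scal (G t) v) (fun t => scal (g t) v)).
  + intros x _; apply (is_derive_scal_l G x (g x) v), HG.
  + intros x _; apply (continuous_scal_l g v x), Hg.
- symmetry; exact (scal_minus_distr_r (G b) (G a) v).
Qed.

(** * The real inner product *)

Section InnerProduct.

Context {H : HilbertSpace}.

(** The real part alone gives the same norm and turns vector identities into real ones;
    [is_adjoint_ip] leads back to the complex inner product. *)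
Definition ip (x y : H) : R := Re (inner x y).

Definition rscal (r : R) (x : H) : H := scal (RtoC r : C_AbsRing) x.

Lemma ip_sym (x y : H) : ip x y = ip y x.
Proof. unfold ip; rewrite (inner_conj H y x); reflexivity. Qed.

Lemma ip_plus_l (x y z : H) : ip (plus x y) z = ip x z + ip y z.
Proof. unfold ip; rewrite inner_plus_l; reflexivity. Qed.

Lemma ip_plus_r (x y z : H) : ip x (plus y z) = ip x y + ip x z.
Proof. rewrite !(ip_sym x); apply ip_plus_l. Qed.

Lemma ip_zero_l (y : H) : ip zero y = 0.
Proof.
generalize (ip_plus_l zero zero y); rewrite (@plus_zero_r H); lra.
Qed.

Lemma ip_rscal_l (r : R) (x y : H) : ip (rscal r x) y = r * ip x y.
Proof. unfold ip, rscal; rewrite inner_scal_l; unfold Re; simpl; ring. Qed.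

Lemma ip_rscal_r (r : R) (x y : H) : ip x (rscal r y) = r * ip x y.
Proof. rewrite !(ip_sym x); apply ip_rscal_l. Qed.

Lemma opp_rscal (x : H) : opp x = rscal (-1) x.
Proof.
unfold rscal.
replace (RtoC (-1) : C_AbsRing) with (opp one : C_AbsRing).
- symmetry; exact (@scal_opp_one C_AbsRing H x).
- apply injective_projections; simpl; ring.
Qed.

Lemma minus_rscal (x y : H) : minus x y = plus x (rscal (-1) y).
Proof. unfold minus; rewrite opp_rscal; reflexivity. Qed.

Lemma ip_minus_l (x y z : H) : ip (minus x y) z = ip x z - ip y z.
Proof. rewrite minus_rscal, ip_plus_l, ip_rscal_l; ring. Qed.

Lemma ip_minus_r (x y z : H) : ip x (minus y z) = ip x y - ip x z.
Proof. rewrite !(ip_sym x); apply ip_minus_l. Qed.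

Lemma ip_scal_conj (k : C) (x y : H) :
  ip (scal (k : C_AbsRing) x) y = ip x (scal (Cconj k : C_AbsRing) y).
Proof.
rewrite (ip_sym x); unfold ip; rewrite !inner_scal_l, (inner_conj H x y).
unfold Re; simpl; ring.
Qed.

Lemma ip_norm (x : H) : ip x x = norm x ^ 2.
Proof. unfold ip; rewrite inner_norm; reflexivity. Qed.

(** Cauchy-Schwarz, from expanding the square of the norm of |y| x - |x| y. *)
Lemma ip_le (x y : H) : ip x y <= norm x * norm y.
Proof.
assert (Hx := norm_ge_0_H x); assert (Hy := norm_ge_0_H y).
destruct (Req_dec (norm y) 0) as [E|E].
{ apply (norm_eq_zero_H (H := H)) in E; subst y.
  rewrite (norm_zero_H (H := H)).
  rewrite ip_sym, ip_zero_l; lra. }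
assert (S : 0 <= norm (minus (rscal (norm y) x) (rscal (norm x) y)) ^ 2)
  by apply pow2_ge_0.
rewrite <- ip_norm, !ip_minus_l, !ip_minus_r, !ip_rscal_l, !ip_rscal_r,
  (ip_sym y x), !ip_norm in S.
destruct (Req_dec (norm x) 0) as [E'|E'].
{ apply (norm_eq_zero_H (H := H)) in E'; subst x.
  rewrite (norm_zero_H (H := H)).
  rewrite ip_zero_l; lra. }
apply Rmult_le_reg_l with (norm x * norm y); [|lra].
apply Rmult_lt_0_compat; lra.
Qed.

Lemma ip_abs_le (x y : H) : Rabs (ip x y) <= norm x * norm y.
Proof.
apply Rabs_le; split; [|apply ip_le].
apply Ropp_le_cancel; rewrite Ropp_involutive, <- (norm_opp_H y).
apply Rle_trans with (2 := ip_le _ _); right.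
rewrite opp_rscal, ip_rscal_r; ring.
Qed.

Lemma ip_ext (y z : H) : (forall x, ip x y = ip x z) -> y = z.
Proof.
intros E; apply (@plus_reg_r H) with (opp z); rewrite (@plus_opp_r H).
apply (norm_eq_zero_H (H := H)), Rsqr_0_uniq.
rewrite Rsqr_pow2, <- ip_norm.
change (plus y (opp z)) with (minus y z).
rewrite ip_minus_r, E; ring.
Qed.

(** * The Riesz theorem and adjoints *)

Lemma riesz (phi : H -> R) (M : R) :
  (forall x y, phi (plus x y) = phi x + phi y) ->
  (forall r x, phi (rscal r x) = r * phi x) ->
  (forall x, phi x <= M * norm x) ->
  exists z, forall x, phi x = ip x z.
Proof.
intros Hp Hs Hb.
(* The representing vector is the minimizer of [J]: if [phi] is given by z, then J x = |x - z|^2 -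
   |z|^2. *)
set (J := fun x => norm x ^ 2 - 2 * phi x).
assert (HJ : forall x y t,
  J (plus x (rscal t y)) = J x + t ^ 2 * norm y ^ 2 + 2 * t * (ip x y - phi y)).
{ intros x y t; unfold J.
  rewrite <- !ip_norm, !ip_plus_l, !ip_plus_r, !ip_rscal_l, !ip_rscal_r,
    Hp, Hs, (ip_sym y x); ring. }
destruct (completeness (fun r => exists x, r = - J x)) as [m [Um Lm]].
(* 2 M |x| - |x|^2 <= M^2, so -[J] is bounded above and its supremum m gives inf [J] = -m. *)
{ exists (M ^ 2); intros r [x ->]; unfold J.
  generalize (Hb x) (pow2_ge_0 (norm x - M)); nra. }
{ exists (- J zero), zero; reflexivity. }
assert (Min : forall x, - m <= J x)
  by (intros x; generalize (Um _ (ex_intro _ x eq_refl)); lra).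
(* Parallelogram law: the left side equals 2 J x + 2 J y - 4 J ((x + y) / 2). Hence minimizing
   sequences are Cauchy. *)
assert (Par : forall x y : H, norm (minus x y) ^ 2 <= 2 * J x + 2 * J y + 4 * m).
{ intros x y; generalize (Min (rscal (/ 2) (plus x y))); unfold J.
  rewrite <- !ip_norm, !ip_minus_l, !ip_minus_r, !ip_rscal_l, !ip_rscal_r,
    !ip_plus_l, !ip_plus_r, Hs, Hp, (ip_sym y x); lra. }
assert (Ex : forall n : nat, exists x, J x < - m + / (INR n + 1)).
{ intros n; apply NNPP; intros Hn.
  assert (P : 0 < / (INR n + 1))
    by (apply Rinv_0_lt_compat; generalize (pos_INR n); lra).
  assert (m <= m - / (INR n + 1)); [|lra].
  apply Lm; intros r [x ->].
  destruct (Rlt_dec (J x) (- m + / (INR n + 1))) as [L|L]; [|lra].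
  destruct Hn; exists x; exact L. }
destruct (choice _ Ex) as [u Hu].
assert (Arch : forall e, 0 < e -> exists N, forall n, (N <= n)%nat ->
  / (INR n + 1) < e).
{ intros e He; destruct (archimed_cor1 e He) as [N [HN PN]].
  exists N; intros n Hn; apply Rle_lt_trans with (2 := HN).
  apply le_INR in Hn; apply lt_INR in PN; simpl in PN.
  apply Rinv_le_contravar; lra. }
destruct (complete_seq u) as [z Hz].
{ intros e He; destruct (Arch (e ^ 2 / 4)) as [N HN].
  { generalize (pow_lt e 2 He); lra. }
  exists N; intros n k Hn Hk.
  apply Rsqr_incrst_0; [|apply norm_ge_0_H|lra].
  rewrite !Rsqr_pow2; apply Rle_lt_trans with (1 := Par _ _).
  generalize (Hu n) (Hu k) (HN n Hn) (HN k Hk); lra. }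
exists z; intros y.
assert (D : Rabs (ip z y - phi y) <= 0).
(* First variation: [u n] is minimal up to s^2, so moving it by s y and by -s y gives |<u n, y> -
   phi y| <= s (|y|^2 + 1) / 2. Replacing [u n] by z costs at most s |y|. *)
{ apply le_0_small with (norm y ^ 2 / 2 + / 2 + norm y); intros s Hs0.
  destruct (Arch (s ^ 2)) as [N1 HN1]; [apply pow_lt; exact Hs0|].
  destruct (Hz s Hs0) as [N2 HN2].
  set (n := (N1 + N2)%nat).
  specialize (HN1 n ltac:(unfold n; lia)).
  specialize (HN2 n ltac:(unfold n; lia)).
  assert (A1 := Min (plus (u n) (rscal s y))); rewrite HJ in A1.
  assert (A2 := Min (plus (u n) (rscal (- s) y))); rewrite HJ in A2.
  assert (Hn := Hu n).
  assert (D1 := ip_abs_le (minus (u n) z) y); rewrite ip_minus_l in D1.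
  assert (D2 : norm (minus (u n) z) * norm y <= s * norm y)
    by (apply Rmult_le_compat_r; [apply norm_ge_0_H | left; exact HN2]).
  apply Rle_trans with (2 := D2) in D1; apply Rabs_le_between in D1.
  set (d := ip (u n) y - phi y) in *; set (j := J (u n)) in *.
  assert (B1 : d <= s * (norm y ^ 2 / 2 + / 2))
    by (apply Rmult_le_reg_l with s; lra).
  assert (B2 : - (s * (norm y ^ 2 / 2 + / 2)) <= d)
    by (apply Rmult_le_reg_l with s; lra).
  unfold d in *; apply Rabs_le; lra. }
apply Rabs_le_between in D; rewrite ip_sym; lra.
Qed.

(** The imaginary part of <u, v> is the real part of <-i u, v>, and [A] commutes with -i. *)
Lemma is_adjoint_ip (A B : bop H) :
  (forall x y, ip (A x) y = ip x (B y)) -> is_adjoint A B.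
Proof.
intros E x y.
assert (Im_ip : forall u v : H, Im (inner u v) = ip (scal (Copp Ci : C_AbsRing) u) v)
  by (intros u v; unfold ip; rewrite inner_scal_l; unfold Re, Im; simpl; ring).
apply injective_projections.
- exact (E x y).
- change (Im (inner (A x) y) = Im (inner x (B y))).
  rewrite !Im_ip, <- E, bop_at_scal; reflexivity.
Qed.

(** Riesz gives [B y] for each y; [ip_ext] makes [B] complex linear, and |B y|^2 = <A (B y), y>
    bounds it. *)
Lemma adjoint_exists (A : bop H) : exists B, is_adjoint A B.
Proof.
assert (Ex : forall y, exists z, forall x, ip (A x) y = ip x z).
{ intros y; apply riesz with (opnorm A * norm y).
  - intros; rewrite bop_at_plus; apply ip_plus_l.
  - intros r x; unfold rscal; rewrite bop_at_scal; apply ip_rscal_l.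
  - intros x; apply Rle_trans with (1 := ip_le _ _).
    assert (L := norm_bop_le A x).
    apply Rmult_le_compat_r with (r := norm y) in L; [lra | apply norm_ge_0_H]. }
destruct (choice _ Ex) as [B HB].
assert (LB : is_linear B).
{ split.
  - intros y z; apply ip_ext; intros x.
    rewrite <- HB, !ip_plus_r, !HB; reflexivity.
  - intros k y; apply ip_ext; intros x.
    rewrite <- HB, <- (Cconj_conj k), <- !ip_scal_conj, <- bop_at_scal.
    apply HB.
  (* [is_linear] asks for a strictly positive bound, hence the added 1. *)
  - exists (opnorm A + 1); assert (P := opnorm_ge0 A); split; [lra|].
    intros y; assert (N := norm_ge_0_H (B y)); assert (Ny := norm_ge_0_H y).
    destruct (Req_dec (norm (B y)) 0) as [E|E]; [nra|].
    apply Rmult_le_reg_l with (norm (B y)); [lra|].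
    apply Rle_trans with (ip (B y) (B y)); [rewrite ip_norm; lra|].
    rewrite <- HB; apply Rle_trans with (1 := ip_le _ _).
    assert (L := norm_bop_le A (B y)).
    apply Rmult_le_compat_r with (r := norm y) in L; [nra | exact Ny]. }
exists (Bop B LB); apply is_adjoint_ip; intros x y; exact (HB y x).
Qed.

Lemma ip_adjoint (A : bop H) (x y : H) : ip (A x) y = ip x (adjoint A y).
Proof.
unfold ip; rewrite (epsilon_spec (inhabits bop_zero) _ (adjoint_exists A) x y).
reflexivity.
Qed.

Definition symmetric_op (A : bop H) : Prop := forall x y, ip (A x) y = ip x (A y).

Lemma bop_at_rscal (A : bop H) (r : R) (x : H) : A (rscal r x) = rscal r (A x).
Proof. apply bop_at_scal. Qed.

Lemma bop_comp_apply (A B : bop H) (x : H) : bop_comp A B x = A (B x).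
Proof. reflexivity. Qed.

Lemma bop_at_minus (A : bop H) (x y : H) : A (minus x y) = minus (A x) (A y).
Proof. rewrite !minus_rscal, bop_at_plus, bop_at_rscal; reflexivity. Qed.

End InnerProduct.

(* Identities between vectors are reduced by [ip_ext] to identities between
   real numbers, where [ring] applies. The operations of [bop H] are unfolded by
   [change] because their canonical structures occur in several convertible but
   syntactically different forms. *)
Ltac expand_ip :=
  unfold bop_sq;
  repeat match goal with
  | |- context [bop_fun (@plus ?G ?A ?B) ?x] =>
      change (bop_fun (@plus G A B) x) with (plus (bop_fun A x) (bop_fun B x))
  | |- context [bop_fun (@minus ?G ?A ?B) ?x] =>
      change (bop_fun (@minus G A B) x) with (minus (bop_fun A x) (bop_fun B x))
  | |- context [bop_fun (@scal ?K ?V ?r ?A) ?x] =>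
      change (bop_fun (@scal K V r A) x) with (rscal r (bop_fun A x))
  | |- context [bop_fun (bop_comp ?A ?B) ?x] =>
      change (bop_fun (bop_comp A B) x) with (bop_fun A (bop_fun B x))
  | |- context [bop_fun bop_id ?x] => change (bop_fun bop_id x) with x
  | _ => rewrite bop_at_plus || rewrite bop_at_minus || rewrite bop_at_rscal
      || rewrite ip_plus_l || rewrite ip_plus_r || rewrite ip_minus_l
      || rewrite ip_minus_r || rewrite ip_rscal_l || rewrite ip_rscal_r
  end.

(** * Operator norm estimates and square roots of positive operators *)

Section Operators.

Context {H : HilbertSpace}.

Lemma norm_rscal (r : R) (x : H) : norm (rscal r x) <= Rabs r * norm x.
Proof. apply norm_scal_R_H. Qed.

Lemma opnorm_comp (A B : bop H) : opnorm (bop_comp A B) <= opnorm A * opnorm B.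
Proof.
assert (HA := opnorm_ge0 A); assert (HB := opnorm_ge0 B).
apply opnorm_le; [now apply Rmult_le_pos|]; intros x.
apply Rle_trans with (1 := norm_bop_le A (B x)).
rewrite Rmult_assoc; apply Rmult_le_compat_l; [exact HA | apply norm_bop_le].
Qed.

Lemma opnorm_id_le : opnorm (bop_id : bop H) <= 1.
Proof. apply opnorm_le; [lra|]; intros x; simpl; lra. Qed.

Lemma ip_bop_le (A : bop H) (x : H) : ip (A x) x <= opnorm A * norm x ^ 2.
Proof.
apply Rle_trans with (1 := ip_le _ _).
assert (L := norm_bop_le A x).
apply Rmult_le_compat_r with (r := norm x) in L; [lra | apply norm_ge_0_H].
Qed.

(* The increments of [sqrt_iter T] are dominated in norm by those of the bounded
   increasing sequence [sqrt_major], so no spectral theory is needed. *)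
Fixpoint sqrt_iter (T : bop H) (n : nat) : bop H :=
  match n with
  | O => bop_zero
  | S n => scal (/ 2) (plus T (bop_comp (sqrt_iter T n) (sqrt_iter T n)))
  end.

(** The recursion of [sqrt_iter] with the number 1 in place of [T]. *)
Fixpoint sqrt_major (n : nat) : R :=
  match n with O => 0 | S n => (1 + sqrt_major n ^ 2) / 2 end.

Lemma sqrt_major_bounds (n : nat) : 0 <= sqrt_major n <= 1.
Proof. induction n; simpl in *; nra. Qed.

Lemma sqrt_major_incr (n : nat) : sqrt_major n <= sqrt_major (S n).
Proof. simpl; generalize (pow2_ge_0 (1 - sqrt_major n)); lra. Qed.

Lemma sqrt_iter_bound (T : bop H) (n : nat) :
  opnorm T <= 1 -> opnorm (sqrt_iter T n) <= sqrt_major n.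
Proof.
intros HT; induction n as [|n IH]; [right; apply opnorm_zero|].
apply Rle_trans with (1 := opnorm_scal _ _).
rewrite Rabs_pos_eq by lra.
assert (L1 := opnorm_triangle T (bop_comp (sqrt_iter T n) (sqrt_iter T n))).
assert (L2 := opnorm_comp (sqrt_iter T n) (sqrt_iter T n)).
assert (L3 := opnorm_ge0 (sqrt_iter T n)).
assert (L4 := Rmult_le_compat _ _ _ _ L3 L3 IH IH).
apply Rle_trans with (/ 2 * (1 + sqrt_major n * sqrt_major n)); [|simpl; right; field].
apply Rmult_le_compat_l; [lra|].
apply Rle_trans with (1 := L1); lra.
Qed.

(** Uses A^2 - B^2 = A (A - B) + (A - B) B, which holds without commutation. *)
Lemma comp_sub_bound (A B : bop H) (x : H) (a : R) :
  opnorm (minus A B) <= a ->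
  norm (minus (A (A x)) (B (B x))) <= opnorm A * (a * norm x) + a * norm (B x).
Proof.
intros Ha.
replace (minus (A (A x)) (B (B x))) with
  (plus (A ((minus A B : bop H) x)) ((minus A B : bop H) (B x)))
  by (apply ip_ext; intros w; expand_ip; ring).
apply Rle_trans with (1 := norm_triangle_H _ _).
apply Rplus_le_compat.
- apply Rle_trans with (1 := norm_bop_le A _).
  apply Rmult_le_compat_l; [apply opnorm_ge0|].
  apply Rle_trans with (1 := norm_bop_le _ _).
  apply Rmult_le_compat_r; [apply norm_ge_0_H | exact Ha].
- apply Rle_trans with (1 := norm_bop_le _ _).
  apply Rmult_le_compat_r; [apply norm_ge_0_H | exact Ha].
Qed.

(** In both recursions the next increment is half a difference of squares: [comp_sub_bound] bounds
    it for operators, and for the majorant it is (a + b) (a - b) / 2. *)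
Lemma sqrt_iter_step (T : bop H) (n : nat) : opnorm T <= 1 ->
  opnorm (minus (sqrt_iter T (S n)) (sqrt_iter T n)) <=
  sqrt_major (S n) - sqrt_major n.
Proof.
intros HT; induction n as [|n IH].
- replace (minus (sqrt_iter T 1) (sqrt_iter T 0)) with (sqrt_iter T 1)
    by (symmetry; exact (@minus_zero_r (@bop_AbelianGroup H) _)).
  change (sqrt_major 0) with 0; rewrite Rminus_0_r.
  now apply sqrt_iter_bound.
- assert (I := sqrt_major_incr (S n)).
  apply opnorm_le; [lra|]; intros x.
  set (Y := sqrt_iter T n) in *; set (Y' := sqrt_iter T (S n)) in *.
  replace ((minus (sqrt_iter T (S (S n))) Y' : bop H) x) with
    (rscal (/ 2) (minus (Y' (Y' x)) (Y (Y x))))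
    by (apply ip_ext; intros w; unfold Y', Y; simpl sqrt_iter; expand_ip; ring).
  apply Rle_trans with (1 := norm_rscal _ _).
  rewrite Rabs_pos_eq by lra.
  assert (C := comp_sub_bound Y' Y x _ IH).
  assert (B' : opnorm Y' <= sqrt_major (S n)) by now apply sqrt_iter_bound.
  assert (B : opnorm Y <= sqrt_major n) by now apply sqrt_iter_bound.
  assert (Nx := norm_ge_0_H x); assert (I' := sqrt_major_incr n).
  assert (E : sqrt_major (S (S n)) - sqrt_major (S n) =
    / 2 * ((sqrt_major (S n) + sqrt_major n) * (sqrt_major (S n) - sqrt_major n)))
    by (simpl; field).
  rewrite E; set (a := sqrt_major (S n)) in *; set (b := sqrt_major n) in *.
  assert (L1 : opnorm Y' * ((a - b) * norm x) <= a * ((a - b) * norm x))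
    by (apply Rmult_le_compat_r; [apply Rmult_le_pos; lra | exact B']).
  assert (L2 : (a - b) * norm (Y x) <= (a - b) * (b * norm x)).
  { apply Rmult_le_compat_l; [lra|].
    apply Rle_trans with (1 := norm_bop_le Y x).
    apply Rmult_le_compat_r; assumption. }
  lra.
Qed.

Lemma sqrt_iter_diff (T : bop H) (n k : nat) : opnorm T <= 1 ->
  opnorm (minus (sqrt_iter T (k + n)) (sqrt_iter T n)) <=
  sqrt_major (k + n) - sqrt_major n.
Proof.
intros HT; induction k as [|k IH].
- simpl; rewrite minus_eq_zero; right; rewrite Rminus_eq_0; apply opnorm_zero.
- rewrite (@minus_trans (@bop_AbelianGroup H) (sqrt_iter T (k + n))).
  apply Rle_trans with (1 := opnorm_triangle _ _).
  generalize (sqrt_iter_step T (k + n) HT); change (S k + n)%nat with (S (k + n)).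
  lra.
Qed.

Lemma sqrt_iter_limit (T : bop H) : opnorm T <= 1 ->
  exists L : bop H, forall eps, 0 < eps -> exists N, forall n, (N <= n)%nat ->
    opnorm (minus (sqrt_iter T n) L) < eps.
Proof.
intros HT; apply (complete_seq (V := @bop_CompleteNormedModule H)).
intros e He.
destruct (proj1 (ex_lim_seq_cauchy_corr sqrt_major)
  (ex_finite_lim_seq_incr sqrt_major 1 sqrt_major_incr
    (fun n => proj2 (sqrt_major_bounds n))) (mkposreal e He)) as [N HN].
simpl in HN; exists N.
assert (Inc : forall n m, (N <= n)%nat -> (n <= m)%nat ->
  opnorm (minus (sqrt_iter T m) (sqrt_iter T n)) < e).
{ intros n m Hn Hm; assert (D := sqrt_iter_diff T n (m - n) HT).
  replace (m - n + n)%nat with m in D by lia.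
  apply Rle_lt_trans with (1 := D).
  apply Rle_lt_trans with (1 := Rle_abs _); apply HN; lia. }
intros n m Hn Hm.
change (opnorm (minus (sqrt_iter T m) (sqrt_iter T n)) < e).
destruct (Nat.le_ge_cases n m); [now apply Inc|].
rewrite <- (@opp_minus (@bop_AbelianGroup H)).
change (opnorm (bop_opp (minus (sqrt_iter T n) (sqrt_iter T m))) < e).
rewrite opnorm_opp; now apply Inc.
Qed.

Lemma sqrt_iter_symmetric (T : bop H) (n : nat) :
  symmetric_op T -> symmetric_op (sqrt_iter T n).
Proof.
intros HT; induction n as [|n IH]; intros x y; simpl sqrt_iter.
- change (ip (zero : H) y = ip x (zero : H)).
  rewrite (ip_sym x), !ip_zero_l; reflexivity.
- expand_ip; rewrite !IH, HT; reflexivity.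
Qed.

(** Symmetry, contractivity and the recursion pass from the iterates to their norm limit; each is
    tested on fixed vectors with an error linear in s. *)
Lemma half_square_fixpoint (T : bop H) : opnorm T <= 1 -> symmetric_op T ->
  exists L : bop H, symmetric_op L /\ (forall x, norm (L x) <= norm x) /\
    forall x, L x = rscal (/ 2) (plus (T x) (L (L x))).
Proof.
intros HT ST; destruct (sqrt_iter_limit T HT) as [L HL].
assert (Near : forall s, 0 < s -> exists n,
  opnorm (minus (sqrt_iter T n) L) < s /\
  opnorm (minus (sqrt_iter T (S n)) L) < s).
{ intros s Hs; destruct (HL s Hs) as [N HN].
  exists N; split; apply HN; lia. }
assert (Y1 : forall n x, norm (sqrt_iter T n x) <= norm x).
{ intros n x; apply Rle_trans with (1 := norm_bop_le _ _).
  assert (B := sqrt_iter_bound T n HT); assert (B' := sqrt_major_bounds n).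
  assert (Nx := norm_ge_0_H x); nra. }
assert (Dist : forall n x s, opnorm (minus (sqrt_iter T n) L) < s ->
  norm (minus (sqrt_iter T n x) (L x)) <= s * norm x).
{ intros n x s Hs; apply Rle_trans with (1 := norm_bop_le (minus (sqrt_iter T n) L) x).
  apply Rmult_le_compat_r; [apply norm_ge_0_H | now left]. }
exists L; split; [|split].
- intros x y.
  assert (D : Rabs (ip (L x) y - ip x (L y)) <= 0).
  { apply le_0_small with (2 * norm x * norm y); intros s Hs.
    destruct (Near s Hs) as [n [Hn _]].
    replace (ip (L x) y - ip x (L y)) with
      (ip x (minus (sqrt_iter T n y) (L y)) - ip (minus (sqrt_iter T n x) (L x)) y)
      by (expand_ip; rewrite (sqrt_iter_symmetric T n ST); ring).
    apply Rle_trans with (1 := Rabs_triang _ _); rewrite Rabs_Ropp.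
    assert (L1 := ip_abs_le x (minus (sqrt_iter T n y) (L y))).
    assert (L2 := ip_abs_le (minus (sqrt_iter T n x) (L x)) y).
    assert (L3 := Rmult_le_compat_l _ _ _ (norm_ge_0_H x) (Dist n y s Hn)).
    assert (L4 := Rmult_le_compat_r _ _ _ (norm_ge_0_H y) (Dist n x s Hn)).
    lra. }
  apply Rabs_le_between in D; lra.
- intros x; apply Rminus_le, le_0_small with (norm x); intros s Hs.
  destruct (Near s Hs) as [n [Hn _]].
  assert (D := Dist n x s Hn); rewrite <- norm_opp_H in D.
  assert (Tr := norm_triangle_H (sqrt_iter T n x)
    (opp (minus (sqrt_iter T n x) (L x)))).
  replace (plus (sqrt_iter T n x) (opp (minus (sqrt_iter T n x) (L x))))
    with (L x) in Tr
    by (apply ip_ext; intros w; rewrite opp_rscal; expand_ip; ring).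
  generalize (Y1 n x); lra.
- intros x; apply ip_ext; intros w; apply Rminus_diag_uniq.
  set (d := minus (L x) (rscal (/ 2) (plus (T x) (L (L x))))).
  assert (D : norm d <= 0).
  { apply le_0_small with (norm x + / 2 * (norm x + norm (L x))); intros s Hs.
    destruct (Near s Hs) as [n [Hn Hn']].
    (* Since the next iterate is (T + Y^2) / 2, the term T x cancels and the defect [d] is a sum of
       two approximation errors. *)
    set (Y := sqrt_iter T n) in *.
    replace d with (plus (rscal (-1) (minus (sqrt_iter T (S n) x) (L x)))
      (rscal (/ 2) (minus (Y (Y x)) (L (L x)))))
      by (apply ip_ext; intros v; unfold d, Y; simpl sqrt_iter; expand_ip; ring).
    apply Rle_trans with (1 := norm_triangle_H _ _).
    assert (L1 := norm_rscal (-1) (minus (sqrt_iter T (S n) x) (L x))).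
    rewrite Rabs_left in L1 by lra.
    assert (L2 := norm_rscal (/ 2) (minus (Y (Y x)) (L (L x)))).
    rewrite Rabs_pos_eq in L2 by lra.
    assert (L3 := Dist (S n) x s Hn').
    assert (L4 := comp_sub_bound Y L x s (Rlt_le _ _ Hn)).
    assert (L5 : opnorm Y <= 1)
      by (apply Rle_trans with (1 := sqrt_iter_bound T n HT), sqrt_major_bounds).
    assert (L6 : opnorm Y * (s * norm x) <= 1 * (s * norm x))
      by (apply Rmult_le_compat_r; [apply Rmult_le_pos; [lra | apply norm_ge_0_H]
        | exact L5]).
    lra. }
  assert (E : d = zero)
    by (apply (norm_eq_zero_H (H := H)), Rle_antisym; [exact D | apply norm_ge_0_H]).
  rewrite <- ip_minus_r; fold d; rewrite E, ip_sym; apply ip_zero_l.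
Qed.

(** [bop_positive] also requires <S x, x> to be real; symmetry makes it equal to its own
    conjugate. *)
Lemma symmetric_positive (S : bop H) :
  symmetric_op S -> (forall x, 0 <= ip (S x) x) -> bop_positive S.
Proof.
intros Sy Ps x; exists (ip (S x) x); split; [apply Ps|].
assert (E := is_adjoint_ip S S Sy x x); rewrite (inner_conj H (S x) x) in E.
apply injective_projections; [reflexivity|].
apply (f_equal snd) in E; simpl in *; lra.
Qed.

Lemma positive_sqrt_exists (T : bop H) :
  symmetric_op T -> (forall x, 0 <= ip (T x) x) ->
  exists S, bop_positive S /\ bop_comp S S = T.
Proof.
intros ST PT.
(* The added 1 keeps k positive even when T = 0. *)
set (k := opnorm T + 1); assert (Nt := opnorm_ge0 T).
assert (Pk : 0 < k) by (unfold k; lra).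
set (R0 := minus bop_id (scal (/ k) T) : bop H).
assert (SR : symmetric_op R0)
  by (intros x y; unfold R0; expand_ip; rewrite ST; reflexivity).
assert (NR : opnorm R0 <= 1).
{ apply opnorm_le; [lra|]; intros x; rewrite Rmult_1_l.
  apply Rsqr_incr_0; try apply norm_ge_0_H.
  rewrite !Rsqr_pow2, <- !ip_norm.
  (* Positivity of T at x - T x / k gives |T x|^2 / k <= <T x, x>. *)
  assert (P := PT (minus x (rscal (/ k) (T x)))).
  assert (Q := ip_bop_le T (T x)); rewrite <- ip_norm in Q.
  revert P; unfold R0; expand_ip; rewrite (ip_sym x (T x)), (ST (T x) x); intros P.
  assert (Pn : 0 <= ip (T x) (T x)) by (rewrite ip_norm; apply pow2_ge_0).
  set (a := ip (T x) x) in *; set (b := ip (T x) (T x)) in *.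
  set (c := ip (T (T x)) (T x)) in *.
  assert (C : c <= k * b) by (unfold k; lra).
  assert (C' : / k * (/ k * c) <= / k * b).
  { apply Rmult_le_reg_l with (k * k); [nra|].
    replace (k * k * (/ k * (/ k * c))) with c by (field; lra).
    replace (k * k * (/ k * b)) with (k * b) by (field; lra); exact C. }
  assert (B : / k * b <= a) by lra.
  assert (Ik : 0 < / k) by now apply Rinv_0_lt_compat.
  apply (Rmult_le_compat_l (/ k)) in B; [nra | lra]. }
destruct (half_square_fixpoint R0 NR SR) as [L [SL [NL FL]]].
set (q := sqrt k).
assert (Hq : q * q = k) by (apply sqrt_sqrt; lra).
assert (Pq : 0 <= q) by apply sqrt_pos.
(* The fixed point equation reads (I - L)^2 = I - R0 = T / k. Positivity of I - L comes from |L x|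
   <= |x|. *)
exists (scal q (minus bop_id L)); split.
- apply symmetric_positive.
  + intros x y; expand_ip; rewrite SL; reflexivity.
  + intros x; expand_ip; apply Rmult_le_pos; [exact Pq|].
    assert (I := ip_le (L x) x); assert (N := NL x).
    apply Rmult_le_compat_r with (r := norm x) in N; [|apply norm_ge_0_H].
    rewrite ip_norm; lra.
- apply bop_ext; intros x; apply ip_ext; intros w.
  assert (F := f_equal (ip w) (FL x)); revert F; unfold R0; expand_ip; intros F.
  replace (q * (q * (ip w x - ip w (L x)) - q * (ip w (L x) - ip w (L (L x)))))
    with (q * q * (ip w x - 2 * ip w (L x) + ip w (L (L x)))) by ring.
  rewrite Hq.
  replace (ip w x - 2 * ip w (L x) + ip w (L (L x))) with (/ k * ip w (T x)) by lra.
  field; lra.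
Qed.

(** A* A is symmetric with <A* A x, x> = |A x|^2, so a positive root exists and [epsilon] picks
    one. *)
Lemma bop_sq_abs (A : bop H) : bop_sq (bop_abs A) = bop_comp (adjoint A) A.
Proof.
assert (E : exists S, bop_positive S /\ bop_comp S S = bop_comp (adjoint A) A).
{ apply positive_sqrt_exists.
  - intros x y; rewrite !bop_comp_apply, <- ip_adjoint, ip_sym, <- ip_adjoint.
    apply ip_sym.
  - intros x; rewrite bop_comp_apply, ip_sym, <- ip_adjoint, ip_norm.
    apply pow2_ge_0. }
exact (proj2 (epsilon_spec (inhabits bop_zero) _ E)).
Qed.

(** * The norm of A D* when A* A + D* D <= K I *)

Lemma opnorm_comp_adjoint_le (A D : bop H) (K : R) :
  0 <= K ->
  (forall y, norm (A y) ^ 2 + norm (D y) ^ 2 <= K * norm y ^ 2) ->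
  opnorm (bop_comp A (adjoint D)) <= K / 2.
Proof.
intros HK HAD.
assert (Main : forall u v, 4 * ip (A (adjoint D v)) u <= K * (norm u ^ 2 + norm v ^ 2)).
{ intros u v.
  set (a := adjoint A u); set (d := adjoint D v).
  set (y := plus a d).
  assert (P : 4 * ip (A d) u <= norm y ^ 2).
  { rewrite ip_adjoint; fold a; rewrite <- ip_norm.
    assert (S := pow2_ge_0 (norm (minus a d))); rewrite <- ip_norm in S.
    revert S; unfold y; expand_ip; rewrite (ip_sym d a); lra. }
  assert (Q : norm y ^ 2 = ip (A y) u + ip (D y) v)
    by (rewrite !ip_adjoint, <- ip_plus_r, ip_norm; reflexivity).
  (* AM-GM: [2 K (<Ay,u> + <Dy,v>) <= |Ay|^2 + |Dy|^2 + K^2 (|u|^2 + |v|^2)] *)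
  assert (S1 := pow2_ge_0 (norm (minus (A y) (rscal K u)))).
  assert (S2 := pow2_ge_0 (norm (minus (D y) (rscal K v)))).
  rewrite <- ip_norm in S1, S2; revert S1 S2; expand_ip.
  rewrite (ip_sym u), (ip_sym v), !ip_norm; intros S1 S2.
  assert (Hy := HAD y).
  (* If K = 0, then A y = D y = 0 and [Q] gives |y|^2 = 0. Otherwise [S1], [S2] and [Hy] give K
     |y|^2 <= K^2 (|u|^2 + |v|^2), and K cancels. *)
  destruct (Req_dec K 0) as [->|E].
  { assert (norm (A y) = 0) by nra; assert (norm (D y) = 0) by nra.
    assert (I1 := ip_le (A y) u); assert (I2 := ip_le (D y) v); nra. }
  apply Rle_trans with (1 := P).
  apply Rmult_le_reg_l with K; nra. }
apply opnorm_le; [lra|]; intros v; rewrite bop_comp_apply.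
set (z := A (adjoint D v)).
assert (Nz := norm_ge_0_H z); assert (Nv := norm_ge_0_H v).
destruct (Req_dec (norm z) 0) as [E|E]; [nra|].
(* Rescaling z to the length of v balances the right side: 4 |v| |z| <= 2 K |v|^2. *)
assert (M := Main (rscal (norm v / norm z) z) v); fold z in M.
rewrite <- !ip_norm in M; revert M; expand_ip; rewrite !ip_norm; intros M.
replace (norm v / norm z * (norm v / norm z * norm z ^ 2)) with (norm v ^ 2) in M
  by (field; exact E).
replace (norm v / norm z * norm z ^ 2) with (norm v * norm z) in M by (field; exact E).
destruct (Req_dec (norm v) 0) as [E'|E'].
- unfold z; apply (norm_eq_zero_H (H := H)) in E'; rewrite E', !bop_at_zero.
  rewrite !norm_zero_H; lra.
- apply Rmult_le_reg_l with (norm v); lra.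
Qed.

End Operators.

(** * The integral in closed form *)

Lemma bop_sq_interpolation {H : HilbertSpace} (P : bop H) (m t : R) :
  bop_sq (plus (scal (1 - t) P) (scal (t * m) bop_id)) =
  plus (scal ((1 - t) ^ 2) (bop_sq P))
    (plus (scal (2 * m * (t * (1 - t))) P) (scal (m ^ 2 * t ^ 2) bop_id)).
Proof. apply bop_ext; intros x; apply ip_ext; intros w; expand_ip; ring. Qed.

(** The integrand is a polynomial in t with fixed operator coefficients; (1 - t)^2, 2 t (1 - t) and
    t^2 each integrate to 1/3. *)
Lemma RInt_sq_interpolation {H : HilbertSpace} (P : bop H) (m : R) :
  RInt (fun t : R => bop_sq (plus (scal (1 - t) P) (scal (t * m) bop_id))) 0 1 =
  plus (scal (/ 3) (bop_sq P)) (plus (scal (m / 3) P) (scal (m ^ 2 / 3) bop_id)).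
Proof.
apply is_RInt_unique.
apply (is_RInt_ext (fun t => plus (scal ((1 - t) ^ 2) (bop_sq P))
  (plus (scal (2 * m * (t * (1 - t))) P) (scal (m ^ 2 * t ^ 2) bop_id)))).
{ intros t _; symmetry; apply bop_sq_interpolation. }
apply @is_RInt_plus; [|apply @is_RInt_plus].
(* Each coefficient is written as G 1 - G 0 for the antiderivative G supplied next. *)
- replace (/ 3) with (- (1 - 1) ^ 3 / 3 - - (1 - 0) ^ 3 / 3) by field.
  apply (is_RInt_scal_vec (V := @bop_CompleteNormedModule H)
    (fun t => - (1 - t) ^ 3 / 3)); intros t.
  + auto_derive; [easy | simpl; field].
  + apply (ex_derive_continuous (fun t => (1 - t) ^ 2)); auto_derive; easy.
- replace (m / 3) with
    (2 * m * (1 ^ 2 / 2 - 1 ^ 3 / 3) - 2 * m * (0 ^ 2 / 2 - 0 ^ 3 / 3)) by field.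
  apply (is_RInt_scal_vec (V := @bop_CompleteNormedModule H)
    (fun t => 2 * m * (t ^ 2 / 2 - t ^ 3 / 3))); intros t.
  + auto_derive; [easy | simpl; field].
  + apply (ex_derive_continuous (fun t => 2 * m * (t * (1 - t)))); auto_derive; easy.
- replace (m ^ 2 / 3) with (m ^ 2 * (1 ^ 3 / 3) - m ^ 2 * (0 ^ 3 / 3)) by field.
  apply (is_RInt_scal_vec (V := @bop_CompleteNormedModule H)
    (fun t => m ^ 2 * (t ^ 3 / 3))); intros t.
  + auto_derive; [easy | simpl; field].
  + apply (ex_derive_continuous (fun t => m ^ 2 * t ^ 2)); auto_derive; easy.
Qed.

Lemma opnorm_quadratic_le {H : HilbertSpace} (P : bop H) (m : R) :
  0 <= m ->
  opnorm (plus (scal (/ 3) (bop_sq P))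
    (plus (scal (m / 3) P) (scal (m ^ 2 / 3) bop_id))) <=
  (opnorm P ^ 2 + m * opnorm P + m ^ 2) / 3.
Proof.
intros Hm.
assert (Scal : forall (r : R) (A : bop H) (M : R), 0 <= r -> opnorm A <= M ->
  opnorm (bop_scal r A) <= r * M).
{ intros r A M Hr HM; apply Rle_trans with (1 := opnorm_scal _ _).
  rewrite Rabs_pos_eq by exact Hr; now apply Rmult_le_compat_l. }
apply Rle_trans with
  (/ 3 * (opnorm P * opnorm P) + (m / 3 * opnorm P + m ^ 2 / 3 * 1)); [|lra].
apply Rle_trans with (1 := opnorm_triangle _ _); apply Rplus_le_compat.
- apply Scal; [lra | apply opnorm_comp].
- apply Rle_trans with (1 := opnorm_triangle _ _); apply Rplus_le_compat.
  + apply Scal; lra.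
  + apply Scal; [generalize (pow2_ge_0 m); lra | apply opnorm_id_le].
Qed.

(** * The quadratic form of |A|^2 + |D|^2 and the two inequalities *)

Lemma ip_sum_sq_abs {H : HilbertSpace} (A D : bop H) (y : H) :
  ip ((plus (bop_sq (bop_abs A)) (bop_sq (bop_abs D)) : bop H) y) y =
  norm (A y) ^ 2 + norm (D y) ^ 2.
Proof.
rewrite !bop_sq_abs; expand_ip.
rewrite !(ip_sym (adjoint _ _)), <- !ip_adjoint, !ip_norm; reflexivity.
Qed.

(** Allows <P^2 y, y> to be read as |P y|^2 in the lower bound for [Q]. *)
Lemma sum_sq_abs_symmetric {H : HilbertSpace} (A D : bop H) :
  symmetric_op (plus (bop_sq (bop_abs A)) (bop_sq (bop_abs D)) : bop H).
Proof.
intros x y; rewrite !bop_sq_abs; expand_ip.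
rewrite !(ip_sym (adjoint _ _)), <- !ip_adjoint, (ip_sym (A y)), (ip_sym (D y)).
reflexivity.
Qed.

Theorem corollary3p16 (H : HilbertSpace) (A D : bop H) :
  norm (bop_comp A (adjoint D)) <=
    sqrt (norm (RInt (fun t : R =>
      bop_sq (plus
        (scal (1 - t)
          (scal (/ 2) (plus (bop_sq (bop_abs A)) (bop_sq (bop_abs D)))))
        (scal (t * norm (bop_comp A (adjoint D))) bop_id))) 0 1))
  /\
  sqrt (norm (RInt (fun t : R =>
      bop_sq (plus
        (scal (1 - t)
          (scal (/ 2) (plus (bop_sq (bop_abs A)) (bop_sq (bop_abs D)))))
        (scal (t * norm (bop_comp A (adjoint D))) bop_id))) 0 1)) <=
    1 / 2 * norm (plus (bop_sq (bop_abs A)) (bop_sq (bop_abs D))).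
Proof.
rewrite RInt_sq_interpolation.
assert (IW := ip_sum_sq_abs A D); assert (SW := sum_sq_abs_symmetric A D).
set (W := plus (bop_sq (bop_abs A)) (bop_sq (bop_abs D))) in *.
change (norm (bop_comp A (adjoint D))) with (opnorm (bop_comp A (adjoint D))).
assert (Bound := opnorm_comp_adjoint_le A D).
assert (Pm := opnorm_ge0 (bop_comp A (adjoint D))).
set (m := opnorm (bop_comp A (adjoint D))) in *.
set (P := scal (/ 2) W).
set (Q := plus (scal (/ 3) (bop_sq P))
  (plus (scal (m / 3) P) (scal (m ^ 2 / 3) bop_id))).
change (norm Q) with (opnorm Q); change (norm W) with (opnorm W).
assert (PQ := opnorm_ge0 Q); assert (PW := opnorm_ge0 W).
split.
- destruct (Req_dec m 0) as [E|E]; [rewrite E; apply sqrt_pos|].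
  assert (Low : forall y, m * (norm (A y) ^ 2 + norm (D y) ^ 2) <=
    2 * opnorm Q * norm y ^ 2).
  { intros y.
    (* [3 <Qy,y> = |Py|^2 + m <Py,y> + m^2 |y|^2 >= 3 m <Py,y>] *)
    assert (S := pow2_ge_0 (norm (minus (P y) (rscal m y)))).
    assert (U := ip_bop_le Q y).
    rewrite <- ip_norm in S; rewrite <- IW; revert S U.
    unfold Q, P; expand_ip; rewrite !(SW (W y) y), !(ip_sym y (W y)), !ip_norm; lra. }
  (* [Low] divided by m > 0 is the hypothesis of [Bound] with K = 2 ||Q|| / m. *)
  assert (B : m <= 2 * opnorm Q / m / 2).
  { apply Bound.
    - apply Rdiv_le_0_compat; lra.
    - intros y; apply Rmult_le_reg_l with m; [lra|].
      replace (m * (2 * opnorm Q / m * norm y ^ 2)) with (2 * opnorm Q * norm y ^ 2)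
        by (field; exact E).
      apply Low. }
  apply Rmult_le_compat_l with (r := m) in B; [|exact Pm].
  replace (m * (2 * opnorm Q / m / 2)) with (opnorm Q) in B by (field; exact E).
  rewrite <- (sqrt_square m Pm); apply sqrt_le_1; nra.
- assert (B : m <= opnorm W / 2).
  { apply Bound; [exact PW|]; intros y; rewrite <- IW; apply ip_bop_le. }
  assert (BP : opnorm P <= opnorm W / 2).
  { apply Rle_trans with (1 := opnorm_scal _ _); rewrite Rabs_pos_eq; lra. }
  assert (PP := opnorm_ge0 P).
  rewrite <- (sqrt_square (1 / 2 * opnorm W)) by lra.
  apply sqrt_le_1; [exact PQ | nra|].
  (* Both m and ||P|| are at most ||W|| / 2, so the mean of ||P||^2, m ||P|| and m^2 is at most
     ||W||^2 / 4. *)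
  apply Rle_trans with (1 := opnorm_quadratic_le P m Pm); nra.
Qed.
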